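(* Let $n\ge 1$ and $r\ge 2$ be integers, let $\mathcal{P}=\{P_1,\dots,P_l\}$ be a partition of $[n]=\{1,\dots,n\}$ with $|P_i|\le r$ for all $i$, and let $\mathcal{F}$ be a family of non-empty subsets of $[n]$. Then $$\chi(\mathrm{KG}^r(\mathcal{F},\mathcal{P}))\ge \left\lceil\frac{\mathrm{ecd}^r(\mathcal{F})}{r-1}\right\rceil.$$
   Context: A set $F\subseteq[n]$ is $\mathcal{P}$-admissible if $|F\cap P_i|\le 1$ for all $i=1,\dots,l$. The $r$-uniform hypergraph $\mathrm{KG}^r(\mathcal{F},\mathcal{P})$ has as vertex set all $\mathcal{P}$-admissible $F\in\mathcal{F}$, and as edges all $r$-subsets $\{F_1,\dots,F_r\}$ of the vertex set whose members are pairwise disjoint. $\chi$ denotes the chromatic number (minimum number of colors in a vertex coloring with no monochromatic edge). An equitable partition of a set $X$ into $r$ parts is a partition $X=X_1\cup\dots\cup X_r$ (parts possibly empty) with $||X_i|-|X_j||\le 1$ for all $i,j$. The equitable $r$-colorability defect $\mathrm{ecd}^r(\mathcal{F})$ is the minimum size of a set $X_0\subseteq[n]$ such that there is an equitable partition $[n]\setminus X_0=X_1\cup\dots\cup X_r$ with no $F\in\mathcal{F}$ and $i\in\{1,\dots,r\}$ satisfying $F\subseteq X_i$. *)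

(* Defs.v *)
(* The ground set {1, ..., n} is encoded as 'I_n. *)
From mathcomp Require Import all_boot all_order all_algebra.

Set Implicit Arguments.
Unset Strict Implicit.
Unset Printing Implicit Defensive.

Section ChromaticNumber.
Variable T : finType.
Implicit Types (E : {set {set T}}) (k : nat).

(* T is the vertex set of a hypergraph with edge set E. *)
Definition monochromatic k (c : {ffun T -> 'I_k}) (e : {set T}) : bool :=
  [exists a : 'I_k, [forall x in e, c x == a]].

Definition colorable E k : bool :=
  [exists c : {ffun T -> 'I_k}, [forall e in E, ~~ monochromatic c e]].

(* The search is bounded by #|T| because the injective coloring is proper as
   soon as every edge has at least two vertices (see colorable_card); outside
   of that case the value is irrelevant. *)
Definition chromatic_number E : nat :=
  [arg min_(k < ord_max : 'I_#|T|.+1 | colorable E k) (k : nat)].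

Lemma colorable_card E : (forall e, e \in E -> 1 < #|e|) -> colorable E #|T|.
Proof.
move=> E2; apply/existsP; exists [ffun x => enum_rank x].
apply/forall_inP => e /E2 /card_gt1P[x [y [xe ye xNy]]].
apply/existsP => -[a /forall_inP ea]; case/eqP: xNy.
by apply: enum_rank_inj; have:= ea x xe; have:= ea y ye;
  rewrite !ffunE => /eqP-> /eqP->.
Qed.

Lemma chromatic_numberP E : (forall e, e \in E -> 1 < #|e|) ->
  colorable E (chromatic_number E) /\
  (forall k, colorable E k -> chromatic_number E <= k).
Proof.
move=> /colorable_card E2; rewrite /chromatic_number.
case: arg_minnP => //= i Ei imin; split=> // k Ek.
have [kT|Tk] := leqP k #|T|; first exact: (imin (Ordinal (kT : k < #|T|.+1))).
by apply: leq_trans (ltnW Tk); rewrite -ltnS.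
Qed.

End ChromaticNumber.

Section Kneser.
Variable n : nat.
Implicit Types (F P : {set {set 'I_n}}) (S : {set 'I_n}).

Definition admissible P S : bool := [forall B in P, #|S :&: B| <= 1].

Definition KG_vertex F P : finType :=
  {S : {set 'I_n} | (S \in F) && admissible P S}.

Definition KG (r : nat) F P : {set {set KG_vertex F P}} :=
  [set e : {set KG_vertex F P} | (#|e| == r) &&
     [forall S1 in e, forall S2 in e,
        (S1 != S2) ==> [disjoint val S1 & val S2]]].

(* Parts are indexed and may be empty, unlike in the library's partition.
   Since i and j both range over all indices, the last clause says that any
   two part sizes differ by at most 1 in absolute value. *)
Definition equitable_partition (r : nat) (D : {set 'I_n})
    (X : {ffun 'I_r -> {set 'I_n}}) : bool :=
  [&& \bigcup_i X i == D,
      [forall i, forall j, (i != j) ==> [disjoint X i & X j]]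
    & [forall i, forall j, #|X i| <= #|X j|.+1]].

Definition equitably_r_colorable_without (r : nat) F
    (X0 : {set 'I_n}) : bool :=
  [exists X : {ffun 'I_r -> {set 'I_n}},
     equitable_partition (~: X0) X &&
     [forall S in F, forall i, ~~ (S \subset X i)]].

(* Removing the whole ground set is always possible when all members of F are
   non-empty (see ecdP), so [set: 'I_n] is a legitimate starting point. *)
Definition ecd (r : nat) F : nat :=
  #|[arg min_(X0 < [set: 'I_n] | equitably_r_colorable_without r F X0) #|X0|]|.

Lemma ecdP r F : set0 \notin F ->
  (exists2 X0, equitably_r_colorable_without r F X0 & #|X0| = ecd r F) /\
  (forall X0, equitably_r_colorable_without r F X0 -> ecd r F <= #|X0|).
Proof.
move=> F0; rewrite /ecd; case: arg_minnP => [|X0 H0 Hmin].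
  apply/existsP; exists [ffun=> set0]; apply/andP; split.
    apply/and3P; split.
    - by rewrite setCT big1 // => i _; rewrite ffunE.
    - by do 2!apply/forallP=> ?; rewrite !ffunE disjoints_subset sub0set implybT.
    - by do 2!apply/forallP=> ?; rewrite !ffunE cards0.
  apply/forall_inP => S SF; apply/forallP => i; rewrite ffunE subset0.
  by apply: contra F0 => /eqP <-.
by split; first exists X0.
Qed.

End Kneser.

(* Main.v *)
Require Import Defs.
From mathcomp Require Import all_boot all_order all_algebra.
From mathcomp Require Import zify ring.

(* For r = p prime, suppose that t colors suffice and that every equitable family of p disjoint sets
   free of members of F misses more than (p - 1) * t points. To a non-zero x in (Z/p u {0})^n one
   attaches a level: the total size of a largest equitable family of admissible subsets of the parts
   x^-1(j), truncated at n - 1 - (p - 1) * t, plus the number of pairs (j, color) such that x^-1(j)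
   contains a vertex of that color. A color never occurs in all p parts, so there are fewer than n
   levels. As the blocks have at most p elements, an x with equal levels in all parts is either not
   invariant under the rotation of Z/p or maximal with its level, so that x also receives a sign in
   Z/p, equivariantly, constant along comparable vectors of the same level. This contradicts a
   Z/p-Tucker lemma: any equivariant sign has a chain of n vectors with distinct consecutive signs.

   The Tucker lemma is the fact that a Z/p-map between free complexes sends a generator of the
   2-periodic resolution to a generator. Chains appear as functionals on cochains, and the sign is
   used to pull back cocycles [coc k] that vanish when two consecutive signs agree.

   Composite r reduces to its factors as in Kriz's theorem. The reduction needs the statement with
   blocks of size at most r * s and vertices with at most s elements per block, for all s. *)

Set Implicit Arguments.
Unset Strict Implicit.
Unset Printing Implicit Defensive.

(** * Cochains on sequences *)

Lemma repeated_neighbours (Y : eqType) (ys : seq Y) :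
  ~~ sorted (fun a b => a != b) ys -> exists l x l', ys = l ++ [:: x, x & l'].
Proof.
case: ys => //= y ys; elim: ys y => //= z ys IH y.
rewrite negb_and negbK => /orP[/eqP->|/IH[l [x [l' ->]]]]; last by exists (y :: l), x, l'.
by exists [::], z, ys.
Qed.

Section Cochains.
Import GRing.Theory.
Local Open Scope ring_scope.
Variables (R : comNzRingType) (X : Type).
Implicit Types (f g : seq X -> R) (x v : X) (m : X -> X) (xs l : seq X).

(** The simplicial coboundary, with the first vertex peeled off. It is augmented: the empty sequence
    is the face of a vertex. *)
Fixpoint cobd f xs : R :=
  if xs is x :: xs' then f xs' - cobd (fun l => f (x :: l)) xs' else 0.

Lemma cobd_ext f g xs :
  (forall l, (size l).+1 = size xs -> f l = g l) -> cobd f xs = cobd g xs.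
Proof.
elim: xs f g => //= x xs IH f g fg; rewrite fg //; congr (_ - _).
by apply: IH => l sl; apply: fg; rewrite /= sl.
Qed.

Lemma cobd0 f xs : (forall l, f l = 0) -> cobd f xs = 0.
Proof.
by elim: xs f => //= x xs IH f f0; rewrite f0 (IH (fun l => f (x :: l))) ?subr0 //.
Qed.

Lemma cobdB f g xs : cobd (fun l => f l - g l) xs = cobd f xs - cobd g xs.
Proof.
elim: xs f g => [|x xs IH] f g /=; first by rewrite subr0.
by rewrite (IH (fun l => f (x :: l)) (fun l => g (x :: l))); ring.
Qed.

Lemma cobd_sum (I : finType) (F : I -> seq X -> R) xs :
  cobd (fun l => \sum_i F i l) xs = \sum_i cobd (F i) xs.
Proof.
elim: xs F => [|x xs IH] F /=; first by rewrite big1.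
by rewrite (IH (fun i l => F i (x :: l))) -sumrB.
Qed.

Lemma cobdK f xs : cobd (cobd f) xs = 0.
Proof.
elim: xs f => //= x xs IH f.
by rewrite cobdB IH subr0 subrr.
Qed.

Definition normalized f := forall l x l', f (l ++ [:: x, x & l']) = 0.

(** The two faces that omit one copy of the repeated vertex coincide and have opposite signs; every
    other face still contains the repetition. *)
Lemma cobd_normalized f : normalized f -> normalized (cobd f).
Proof.
move=> nf l x l'; elim: l f nf => [|y l IH] f nf /=.
  by rewrite opprB addrC subrK cobd0 // => k; apply: (nf [::]).
rewrite nf (IH (fun k => f (y :: k))) ?subr0 // => k z k'.
exact: (nf (y :: k)).
Qed.

(* The chain homotopy between the identity and [map m], and the cone with apex v built on it: in a
   poset, with [m x] the join of x and v, these are the barycentric subdivisions of the usual ones. *)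
Fixpoint prism m f xs : R :=
  if xs is x :: xs' then f [:: x, m x & map m xs'] - prism m (fun l => f (x :: l)) xs' else 0.

Definition cone m v f xs : R := f (v :: map m xs) - prism m f xs.

Lemma prism_ext m f g xs :
  (forall l x l', xs = l ++ x :: l' ->
     f (l ++ [:: x, m x & map m l']) = g (l ++ [:: x, m x & map m l'])) ->
  prism m f xs = prism m g xs.
Proof.
elim: xs f g => //= x xs IH f g fg; rewrite (fg [::]) //; congr (_ - _).
by apply: IH => l y l' xsE; apply: (fg (x :: l)); rewrite xsE.
Qed.

Lemma prismB m f g xs : prism m (fun l => f l - g l) xs = prism m f xs - prism m g xs.
Proof.
elim: xs f g => [|x xs IH] f g /=; first by rewrite subr0.
by rewrite (IH (fun l => f (x :: l)) (fun l => g (x :: l))); ring.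
Qed.

End Cochains.

Section Cone.
Import GRing.Theory.
Local Open Scope ring_scope.
Variables (R : comNzRingType).

Lemma cobd_map (X Y : Type) (h : X -> Y) (f : seq Y -> R) xs :
  cobd (fun l => f (map h l)) xs = cobd f (map h xs).
Proof. by elim: xs f => //= x xs IH f; rewrite -(IH (fun l => f (h x :: l))). Qed.

Variables (X : Type) (m : X -> X) (v : X).
Implicit Types (f : seq X -> R).

Lemma prism_cobd f xs :
  prism m (cobd f) xs = f (map m xs) - f xs - cobd (prism m f) xs.
Proof.
elim: xs f => [|x xs IH] f /=; first by rewrite subrr subr0.
rewrite prismB cobdB.
rewrite (cobd_map m (fun l => f [:: x, m x & l])).
by rewrite (IH (fun l => f (x :: l))) /=; ring.
Qed.

(** The face opposite to [v] cancels against the far end of the prism, so [cone] is a contracting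
    homotopy of the augmented complex. *)
Lemma cone_cobd f xs : cone m v (cobd f) xs = f xs - cobd (cone m v f) xs.
Proof.
rewrite /cone prism_cobd /= cobdB (cobd_map m (fun l => f (v :: l))); ring.
Qed.

End Cone.

(** * The periodic resolution of Z/p and its sign cocycles *)

Section Twist.
Import GRing.Theory.
Local Open Scope ring_scope.
Variables (p : nat) (X : Type) (act : 'F_p -> X -> X).
Hypothesis actD : forall a b x, act a (act b x) = act (a + b) x.
Implicit Types (f g : seq X -> 'F_p) (b : bool) (xs : seq X).

(* The two maps [sum_a act a] and [act 1 - id] of the 2-periodic resolution of Z over Z[Z/p]. *)
Definition twist b f xs : 'F_p :=
  if b then \sum_a f (map (act a) xs) else f (map (act 1) xs) - f xs.

Lemma twist_ext b f g xs :
  (forall a, f (map (act a) xs) = g (map (act a) xs)) -> f xs = g xs ->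
  twist b f xs = twist b g xs.
Proof.
by rewrite /twist => fg fg0; case: b; [apply: eq_bigr => a _; rewrite fg | rewrite fg fg0].
Qed.

Lemma twistB b f g xs : twist b (fun l => f l - g l) xs = twist b f xs - twist b g xs.
Proof. by rewrite /twist; case: b; [rewrite sumrB | ring]. Qed.

Lemma map_actD (a a' : 'F_p) xs : map (act a) (map (act a') xs) = map (act (a + a')) xs.
Proof. by rewrite -map_comp; apply: eq_map => x /=; rewrite actD. Qed.

Lemma twistK b f xs : twist (~~ b) (twist b f) xs = 0.
Proof.
have shift c : \sum_a f (map (act (c + a)) xs) = \sum_a f (map (act a) xs).
  by rewrite [RHS](reindex_inj (addrI c)).
case: b; rewrite /twist /=.
  under eq_bigr do rewrite map_actD addrC.
  by rewrite shift subrr.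
by under eq_bigr do rewrite map_actD; rewrite sumrB shift subrr.
Qed.

Lemma twist_cobd b f xs : twist b (cobd f) xs = cobd (twist b f) xs.
Proof.
rewrite /twist; case: b.
  by rewrite cobd_sum; apply: eq_bigr => a _; rewrite cobd_map.
by rewrite cobdB cobd_map.
Qed.

End Twist.

Section SignCocycles.
Import GRing.Theory.
Local Open Scope ring_scope.
Variable p : nat.
Hypothesis p_pr : prime p.
Implicit Types (c : seq 'F_p -> 'F_p) (b : bool) (us : seq 'F_p).

Local Notation tw := (twist (fun a u : 'F_p => u + a)).

(** A section of [twist b] on the kernel of [twist (~~ b)]. The sequences with head 0 represent the
    free orbits: for b true, c is kept on the representatives only; for b false, it is summed along
    the orbit from the representative up to [us], excluded. *)
Definition lift_coc b c us : 'F_p :=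
  let u := head 0 us in
  if b then if u == 0 then c us else 0
  else \sum_(j < u) c (map (fun w => w + (j%:R - u)) us).

Lemma lift_coc_normalized b c : normalized c -> normalized (lift_coc b c).
Proof.
move=> nc l x l'; rewrite /lift_coc; case: b; first by rewrite nc if_same.
by apply: big1 => j _; rewrite map_cat /= nc.
Qed.

Lemma twist_lift_coc b c us :
  (0 < size us)%N -> (forall ws, size ws = size us -> tw (~~ b) c ws = 0) ->
  tw b (lift_coc b c) us = c us.
Proof.
case: us => // u us _; set l := u :: us => c0.
have map0 : map (fun w => w + 0) l = l by apply: map_id_in => w _; rewrite addr0.
case: b c0 => c0; rewrite /twist /lift_coc.
  have inv1 ws : size ws = size l -> c (map (fun w => w + 1) ws) = c ws.
    by move=> /c0 /eqP; rewrite /twist /= subr_eq0 => /eqP.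
  have inv a : c (map (fun w => w + a) l) = c l.
    rewrite -[a]natr_Zp; elim: (a : nat) => [|k IH]; first by rewrite map0.
    rewrite -IH -[RHS]inv1 ?size_map // -map_comp; congr c; apply: eq_map => w /=.
    by rewrite -addrA natr1.
  have hd a : head 0 (map (fun w => w + a) l) = u + a by [].
  (* Only the translate by [- u] has head 0, and c is invariant. *)
  rewrite (bigD1 (- u)) // hd subrr eqxx inv big1 => [|a au]; first exact: addr0.
  by rewrite hd addrC addr_eq0 (negPf au).
rewrite /=; set G := fun j : nat => c (map (fun w => w + (j%:R - u)) l).
have sumG : \sum_(j < (Zp_trunc (pdiv p)).+2) G j = 0.
  have /c0 : size (map (fun w => w - u) l) = size l by rewrite size_map.
  rewrite /twist /= => c00; rewrite -[RHS]c00; apply: eq_bigr => j _; rewrite /G natr_Zp -!map_comp.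
  by congr c; apply: eq_map => w /=; rewrite -addrA [- u + j]addrC.
have -> : \sum_(j < u) c (map (fun w => w + (j%:R - u)) l) = \sum_(j < u) G j by [].
have -> : \sum_(j < (u + 1)%R) c (map (fun w => w + (j%:R - (u + 1))) (map (fun w => w + 1) l))
    = \sum_(j < (u + 1)%R) G j.
  apply: eq_bigr => j _; rewrite /G -map_comp; congr c; apply: eq_map => w /=; ring.
have Gu : G u = c l by rewrite /G natr_Zp subrr map0.
(* The sums telescope, except that the last head wraps around to 0, where the sum is empty; there
   the vanishing of the sum over the whole orbit is used. *)
have := ltn_ord u; rewrite leq_eqVlt => /orP[/eqP uE|u1].
  have -> : ((u + 1)%R : nat) = 0%N by rewrite /= [(1 %% _)%N]modn_small // addn1 uE modnn.
  have : \sum_(j < u.+1) G j = 0 by rewrite uE.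
  rewrite big_ord0 sub0r big_ord_recr /= Gu addrC => /eqP.
  by rewrite addr_eq0 => /eqP ->.
have -> : ((u + 1)%R : nat) = u.+1 by rewrite /= [(1 %% _)%N]modn_small // addn1 modn_small.
by rewrite big_ord_recr /= Gu; ring.
Qed.

(** The connecting maps of the resolution, iterated from the augmentation: lift along [twist], then
    take the coboundary. *)
Fixpoint coc k : seq 'F_p -> 'F_p :=
  if k is k'.+1 then cobd (lift_coc (odd k') (coc k')) else fun us => (size us == 1)%:R.

(** In degree 0 the orbit sum is p, which is 0 in 'F_p. In higher degrees [twist] commutes with
    [cobd] and undoes the lift, which leaves the coboundary of the previous cocycle. *)
Lemma twist_coc k us : size us = k.+1 -> tw (~~ odd k) (coc k) us = 0.
Proof.
elim: k us => [|k IH] us sus /=.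
  rewrite /twist /=; under eq_bigr do rewrite size_map sus.
  by rewrite sumr_const card_Fp //; apply: pcharf0; apply: pchar_Fp.
rewrite negbK twist_cobd.
rewrite (@cobd_ext _ _ _ (coc k)); last first.
  by move=> l; rewrite sus => -[sl]; apply: twist_lift_coc; rewrite ?sl // => ws /IH.
case: k {IH} sus => [|k] sus; last by rewrite /= cobdK.
by case: us sus => [|u [|v []]] //= _; ring.
Qed.

Lemma coc_normalized k : normalized (coc k).
Proof.
elim: k => [l x l'|k IH] /=; first by rewrite size_cat !addnS.
by apply: cobd_normalized; apply: lift_coc_normalized.
Qed.

End SignCocycles.

(** * A Z/p-Tucker lemma *)

Section SignedSets.
Import GRing.Theory.
Local Open Scope ring_scope.
Variables (p : nat) (T : finType).

(* The entry [None] stands for 0, and 0 : 'F_p is one of the p signs. *)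
Definition sgvec := {ffun T -> option 'F_p}.
Implicit Types (x y z : sgvec) (e : T) (l : seq T) (xs : seq sgvec).

Definition turn (a : 'F_p) x : sgvec := [ffun i => omap (fun u => u + a) (x i)].
Definition sgle x y := [forall i, x i ==> (x i == y i)].
Definition adjoin e x : sgvec := [ffun i => if i == e then Some 0 else x i].
Definition sgpoint e : sgvec := adjoin e [ffun=> None].
Definition signed_on (A : {pred T}) x := [exists i, x i] && [forall i, x i ==> (i \in A)].

Lemma sgleP x y : reflect (forall i, x i -> x i = y i) (sgle x y).
Proof. 
apply: (iffP forallP) => xy i; last by apply/implyP => /xy ->.
by move=> xi; apply/eqP; apply: (implyP (xy i)).
Qed.

Lemma turnD a b x : turn a (turn b x) = turn (a + b) x.
Proof.
by apply/ffunP => i; rewrite !ffunE; case: (x i) => //= u; rewrite -addrA [b + a]addrC.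
Qed.

Lemma turn_sgle a x y : sgle x y -> sgle (turn a x) (turn a y).
Proof.
move=> /sgleP xy; apply/sgleP => i; rewrite !ffunE.
by have := xy i; case: (x i) => // u <-.
Qed.

Lemma signed_on_turn A a x : signed_on A (turn a x) = signed_on A x.
Proof.
rewrite /signed_on; congr (_ && _).
  by apply: eq_existsb => i; rewrite ffunE; case: (x i).
by apply: eq_forallb => i; rewrite ffunE; case: (x i).
Qed.

Lemma sgle_adjoin e x : ~~ x e -> sgle x (adjoin e x).
Proof.
move=> xe; apply/sgleP => i xi; rewrite ffunE; case: eqP => // ie.
by rewrite ie (negPf xe) in xi.
Qed.

Lemma adjoin_sgle e x y : sgle x y -> sgle (adjoin e x) (adjoin e y).
Proof. by move=> /sgleP xy; apply/sgleP => i; rewrite !ffunE; case: ifP => // _; apply: xy. Qed.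

Lemma signed_on_adjoin l e x : signed_on (mem l) x -> signed_on (mem (e :: l)) (adjoin e x).
Proof.
case/andP => _ /forallP xl; apply/andP; split; first by apply/existsP; exists e; rewrite ffunE eqxx.
apply/forallP => i; rewrite ffunE inE; case: eqP => //= _; exact: xl.
Qed.

Lemma signed_on_point e l : signed_on (mem (e :: l)) (sgpoint e).
Proof.
apply/andP; split; first by apply/existsP; exists e; rewrite ffunE eqxx.
by apply/forallP => i; rewrite !ffunE inE; case: eqP.
Qed.

Lemma signed_on_cons l e x : signed_on (mem l) x -> signed_on (mem (e :: l)) x.
Proof.
case/andP => x0 /forallP xl; apply/andP; split=> //.
by apply/forallP => i; apply/implyP => /(implyP (xl i)); rewrite inE orbC => ->.
Qed.

(** The simplices of dimension [size l - 1] in the order complex of the non-zero signed vectors on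
    l, degenerate ones included since [sgle] is reflexive. *)
Definition flag_on l xs := [&& size xs == size l, sorted sgle xs & all (signed_on (mem l)) xs].

Lemma flag_on_turn a l xs : flag_on l xs -> flag_on l (map (turn a) xs).
Proof.
case/and3P => sx sox ax; apply/and3P; split; first by rewrite size_map.
  by apply: homo_sorted sox => x y; apply: turn_sgle.
by rewrite all_map; apply: sub_all ax => x /=; rewrite signed_on_turn.
Qed.

Lemma flag_on_cone l e xs : flag_on l xs -> flag_on (e :: l) (sgpoint e :: map (adjoin e) xs).
Proof.
case/and3P => sx sox ax; apply/and3P; split; first by rewrite /= size_map.
  case: xs sox {sx ax} => //= x xs sox; apply/andP; split.
    by apply/sgleP => i; rewrite !ffunE; case: eqP.
  by rewrite path_map; apply: sub_path sox => y z; apply: adjoin_sgle.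
rewrite /= signed_on_point all_map; apply: sub_all ax => x; exact: signed_on_adjoin.
Qed.

Lemma flag_on_prism l e xs x xs' : e \notin l -> flag_on l (xs ++ x :: xs') ->
  flag_on (e :: l) (xs ++ [:: x, adjoin e x & map (adjoin e) xs']).
Proof.
move=> el /and3P[sx sox ax]; apply/and3P; split.
- by rewrite [size (e :: l)]/= -(eqP sx) !size_cat /= size_map !addnS.
- have xe : sgle x (adjoin e x).
    move: ax; rewrite all_cat /= => /and3P[_ /andP[_ /forallP/(_ e) xel] _].
    by apply: sgle_adjoin; apply: contra el => /(implyP xel).
  have path_adjoin : path sgle x xs' -> path sgle x (adjoin e x :: map (adjoin e) xs').
    rewrite /= xe path_map => xsle; apply: sub_path xsle => y z; exact: adjoin_sgle.
  case: xs sox {sx ax} => [|y xs] /=; first by move=> /path_adjoin; rewrite /= xe.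
  by rewrite !cat_path => /andP[-> /= /andP[-> /path_adjoin]].
- move: ax; rewrite !all_cat /= all_map => /and3P[a1 a2 a3].
  rewrite (signed_on_cons e a2) (signed_on_adjoin e a2).
  rewrite (sub_all _ a1) ?(sub_all _ a3) // => y; first exact: signed_on_adjoin.
  exact: signed_on_cons.
Qed.

Local Notation cochain := (seq sgvec -> 'F_p).
Implicit Types f g : cochain.

(* Evaluation on the k-chain h_k, k = size l, with boundary [twist (odd (k - 1)) h_(k - 1)], in the
   barycentric subdivision of the adjoin of the discrete Z/p-sets over the coordinates e0 :: l. *)
Fixpoint resolution_chain e0 l f : 'F_p :=
  if l is e :: l' then
    resolution_chain e0 l' (twist turn (odd (size l')) (cone (adjoin e) (sgpoint e) f))
  else f [:: sgpoint e0].

Lemma cone_ext l e f g xs : e \notin l -> flag_on l xs ->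
  (forall ys, flag_on (e :: l) ys -> f ys = g ys) ->
  cone (adjoin e) (sgpoint e) f xs = cone (adjoin e) (sgpoint e) g xs.
Proof.
move=> el xsl fg; rewrite /cone fg ?flag_on_cone //; congr (_ - _).
apply: prism_ext => ys x ys' xsE; apply: fg.
by apply: flag_on_prism; rewrite -?xsE.
Qed.

(** The chain is supported on full flags: cones and prisms over flags on l are flags on [e :: l]. *)
Lemma resolution_chain_ext e0 l f g : uniq (rcons l e0) ->
  (forall xs, flag_on (rcons l e0) xs -> f xs = g xs) ->
  resolution_chain e0 l f = resolution_chain e0 l g.
Proof.
elim: l f g => [|e l IH] f g /= u fg.
  apply: fg; apply/and3P; split => //; rewrite all_seq1; exact: signed_on_point.
case/andP: u => el u; apply: IH => // xs xsl.
apply: twist_ext => [a|]; apply: cone_ext fg => //; exact: flag_on_turn.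
Qed.

Lemma resolution_chain_eq e0 l f g : f =1 g -> resolution_chain e0 l f = resolution_chain e0 l g.
Proof.
elim: l f g => [|e l IH] f g /= fg //; apply: IH => xs.
by apply: twist_ext => [a|]; rewrite /cone fg; congr (_ - _); apply: prism_ext.
Qed.

Lemma resolution_chainB e0 l f g :
  resolution_chain e0 l (fun xs => f xs - g xs)
  = resolution_chain e0 l f - resolution_chain e0 l g.
Proof.
elim: l f g => [|e l IH] f g //=; rewrite -IH; apply: (@resolution_chain_eq e0 l) => xs.
rewrite -twistB; apply: twist_ext => [a|]; rewrite /cone prismB; ring.
Qed.

Lemma resolution_chain0 e0 l f : f =1 (fun=> 0) -> resolution_chain e0 l f = 0.
Proof.
move=> f0; rewrite (resolution_chain_eq e0 l (g := fun xs => f xs - f xs)).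
  by rewrite resolution_chainB subrr.
by move=> xs; rewrite subrr f0.
Qed.

Lemma resolution_chain_step e0 e l f :
  resolution_chain e0 (e :: l) (cobd f) =
  resolution_chain e0 l (twist turn (odd (size l)) f)
  - resolution_chain e0 l (twist turn (odd (size l)) (cobd (cone (adjoin e) (sgpoint e) f))).
Proof.
rewrite -resolution_chainB; apply: (@resolution_chain_eq e0 l) => xs.
by rewrite -twistB; apply: twist_ext => [a|]; rewrite cone_cobd.
Qed.

(** Dually, the twisted chain is a cycle: its boundary is the composite of two consecutive twists,
    which is 0. This removes the error term of the preceding step. *)
Lemma resolution_chain_twist_cobd e0 l f :
  resolution_chain e0 l (twist turn (odd (size l)) (cobd f)) = 0.
Proof.
elim: l f => [|e l IH] f; first by rewrite /= /twist /= subrr.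
rewrite (resolution_chain_eq _ _ (g := cobd (twist turn (odd (size l).+1) f))); last first.
  by move=> xs; apply: twist_cobd.
rewrite resolution_chain_step IH subr0; apply: resolution_chain0 => xs.
by rewrite -[odd (size l)]negbK; apply: (twistK turnD).
Qed.

Lemma resolution_chain_cobd e0 e l f :
  resolution_chain e0 (e :: l) (cobd f) = resolution_chain e0 l (twist turn (odd (size l)) f).
Proof. by rewrite resolution_chain_step resolution_chain_twist_cobd subr0. Qed.

Hypothesis p_pr : prime p.
Variable s : sgvec -> 'F_p.

(** The boundary formula moves [cobd] to the chain as a twist; equivariance of s carries this twist
    over to the signs, where it undoes [lift_coc]. So the value does not depend on the degree, and
    in degree 0 it is 1. *)
Lemma resolution_chain_coc e0 l : uniq (rcons l e0) ->
  (forall a x, signed_on (mem (rcons l e0)) x -> s (turn a x) = s x + a) ->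
  resolution_chain e0 l (fun xs => coc (size l) (map s xs)) = 1.
Proof.
elim: l => [|e l IH] //; rewrite [rcons _ _]/= [uniq _]/= => /andP[el u] sE.
have sE' a x : signed_on (mem (rcons l e0)) x -> s (turn a x) = s x + a.
  by move=> /(signed_on_cons e); apply: sE.
rewrite (resolution_chain_eq e0 (e :: l)
  (g := cobd (fun xs => lift_coc (odd (size l)) (coc (size l)) (map s xs)))); last first.
  by move=> xs; rewrite cobd_map.
rewrite resolution_chain_cobd -[RHS]IH //; apply: resolution_chain_ext => // xs xsl.
have /eqP sxs : size xs == (size l).+1 by case/and3P: xsl; rewrite size_rcons.
rewrite -[RHS](twist_lift_coc (b := odd (size l))) ?size_map ?sxs //; last first.
  by move=> ws; apply: (twist_coc p_pr).
have smap a : map s (map (turn a) xs) = map (fun u => u + a) (map s xs).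
  rewrite -!map_comp; apply/eq_in_map => x xxs /=; apply: sE'.
  by case/and3P: xsl => _ _ /allP; apply.
by rewrite /twist; case: odd; [apply: eq_bigr => a _|]; rewrite !smap.
Qed.

(** Otherwise the normalized cocycle, pulled back along s, would vanish on every full flag, whereas
    the chain gives it the value 1. *)
Lemma alternating_flag (l : seq T) : uniq l ->
  (forall a x, signed_on (mem l) x -> s (turn a x) = s x + a) ->
  exists2 xs, flag_on l xs & sorted (fun x y => s x != s y) xs.
Proof.
case/lastP: l => [|l e0] u sE; first by exists [::].
have [/existsP[ys /andP[ysf ysa]]|no] := boolP [exists ys : (size (rcons l e0)).-tuple sgvec,
    flag_on (rcons l e0) ys && sorted (fun x y => s x != s y) ys].
  by exists ys.
have /eqP := resolution_chain_coc u sE; rewrite (@resolution_chain_ext _ _ _ (fun=> 0)) //.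
  by rewrite resolution_chain0 // eq_sym oner_eq0.
move=> xs xsf; have sxs : size xs == size (rcons l e0) by case/and3P: xsf.
move: no; rewrite negb_exists => /forallP/(_ (Tuple sxs)); rewrite xsf /= => nalt.
have [|u1 [b [u2 ->]]] := @repeated_neighbours _ (map s xs); first by rewrite sorted_map.
exact: coc_normalized.
Qed.

End SignedSets.

(** Along an alternating flag of #|D| vectors the levels increase strictly, so they are #|D|
    distinct numbers below m. *)
Lemma signed_on_tucker (p : nat) (T : finType) (D : {set T}) (s : sgvec p T -> 'F_p)
    (lev : sgvec p T -> nat) (m : nat) : prime p ->
  (forall a x, signed_on (mem D) x -> s (turn a x) = (s x + a)%R) ->
  (forall x y, signed_on (mem D) x -> signed_on (mem D) y -> sgle x y -> lev x <= lev y) ->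
  (forall x y, signed_on (mem D) x -> signed_on (mem D) y -> sgle x y -> lev x = lev y ->
     s x = s y) ->
  (forall x, signed_on (mem D) x -> lev x < m) -> #|D| <= m.
Proof.
move=> p_pr sE lev_le lev_s lev_m.
have memD x : signed_on (mem (enum D)) x = signed_on (mem D) x.
  by congr (_ && _); apply: eq_forallb => i; rewrite /= mem_enum.
have [|xs /and3P[sx sox ax] alt] := alternating_flag p_pr (enum_uniq D) (s := s).
  by move=> a x; rewrite memD; apply: sE.
have {}ax x : x \in xs -> signed_on (mem D) x by move=> /(allP ax); rewrite memD.
have lt_lev : sorted ltn (map lev xs).
  rewrite sorted_map; case: xs {sx} => //= x xs in sox ax alt *.
  elim: xs x sox ax alt => //= y xs IH x /andP[xy sox] ax /andP[sxy alt].
  apply/andP; split; last by apply: IH => // z zxs; apply: ax; rewrite inE zxs orbT.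
  have [xD yD] : signed_on (mem D) x /\ signed_on (mem D) y.
    by split; apply: ax; rewrite !inE eqxx ?orbT.
  rewrite /= ltn_neqAle lev_le // andbT; apply: contra sxy => /eqP levE.
  by apply/eqP; apply: lev_s.
rewrite cardE -(eqP sx) -(size_map lev) -[m](size_iota 0); apply: uniq_leq_size.
  exact: sorted_uniq ltn_trans ltnn _ lt_lev.
by move=> _ /mapP[x xxs ->]; rewrite mem_iota lev_m ?ax.
Qed.

(** * Equivariant signs of non-constant families *)

Section Pivot.
Import GRing.Theory.
Local Open Scope ring_scope.
Variables (p : nat) (V : choiceType).
Implicit Types (w : {ffun 'F_p -> V}) (a : 'F_p).

Definition shift_ffun (U : Type) a (w : {ffun 'F_p -> U}) : {ffun 'F_p -> U} :=
  [ffun j => w (j - a)].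

Lemma shift_ffunE (U : Type) a (w : {ffun 'F_p -> U}) j : shift_ffun a w j = w (j - a).
Proof. by rewrite ffunE. Qed.

Lemma shift_ffunD (U : Type) a a' (w : {ffun 'F_p -> U}) :
  shift_ffun a (shift_ffun a' w) = shift_ffun (a + a') w.
Proof. by apply/ffunP => j; rewrite !ffunE opprD addrA. Qed.

Lemma shift_ffun0 w : shift_ffun 0 w = w.
Proof. by apply/ffunP => j; rewrite !ffunE subr0. Qed.

Lemma shift_ffun_free a w j k : w j != w k -> shift_ffun a w = w -> a = 0.
Proof.
move=> wjk wa; apply/eqP; apply: contraR wjk => a0; apply/eqP.
have step (n : nat) i : w i = w (i - a * n%:R).
  elim: n i => [|n IH] i; first by rewrite mulr0 subr0.
  rewrite IH -[in LHS]wa ffunE; congr (w _); rewrite -natr1; ring.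
(* A non-zero a generates Z/p: [(j - k) / a] steps of length a lead from j to k. *)
rewrite (step ((j - k) / a) j) natr_Zp; congr (w _); rewrite mulrC divfK //; ring.
Qed.

(** The sign of w is the shift that carries the chosen representative of its orbit to w. It is
    unique because the orbit of a non-constant family is free. *)
Lemma exists_pivot : exists pivot : {ffun 'F_p -> V} -> 'F_p,
  forall a w j k, w j != w k -> pivot (shift_ffun a w) = pivot w + a.
Proof.
pose orb w u := [exists a, shift_ffun a u == w].
pose rep w := choose (orb w) w.
have orb_id w : orb w w by apply/existsP; exists 0; rewrite shift_ffun0.
have repP w : orb w (rep w) by apply: chooseP.
have rep_shift a w : rep (shift_ffun a w) = rep w.
  have orbE : orb (shift_ffun a w) =1 orb w.
    move=> u; apply/existsP/existsP => -[d /eqP dE].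
      (* A shift does not change the orbit, hence not the element chosen in it. *)
      exists (d - a); apply/eqP; rewrite addrC -shift_ffunD dE shift_ffunD addrC subrr.
      exact: shift_ffun0.
    by exists (a + d); rewrite -shift_ffunD dE.
  by rewrite /rep (eq_choose orbE); apply: choose_id => //; rewrite -orbE.
exists (fun w => odflt 0 [pick a | shift_ffun a (rep w) == w]) => a w j k wjk.
rewrite rep_shift; case: pickP => [d /eqP dE|no]; last first.
  have /existsP[d] := repP (shift_ffun a w).
  by rewrite rep_shift no.
case: pickP => [d' /eqP dE'|no]; last by have /existsP[d'] := repP w; rewrite no.
have : shift_ffun (d - a - d') w = w.
  rewrite -[in LHS]dE' shift_ffunD subrK addrC -shift_ffunD dE shift_ffunD addrC subrr.
  exact: shift_ffun0.
move=> /(shift_ffun_free wjk)/eqP; rewrite subr_eq0 subr_eq => /eqP /= ->.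
by [].
Qed.

End Pivot.

(** * The bound for prime r *)

Section Thin.
Variables (T I : finType) (b : T -> I) (s : nat).
Implicit Types (S Y : {set T}).

Definition fib S i := [set u in S | b u == i].
Definition thin S := [forall i, #|fib S i| <= s].
Definition thin_card S := \sum_i minn s #|fib S i|.

Lemma fibS S Y i : S \subset Y -> fib S i \subset fib Y i.
Proof. by move=> /subsetP SY; apply/subsetP => u; rewrite !inE => /andP[/SY -> ->]. Qed.

Lemma sum_card_fib S : \sum_i #|fib S i| = #|S|.
Proof.
rewrite -sum1_card (partition_big b predT) //=; apply: eq_bigr => i _.
by rewrite -sum1_card; apply: eq_bigl => u; rewrite inE.
Qed.

Lemma thin_sub S Y : S \subset Y -> thin Y -> thin S.
Proof.
move=> SY /forallP Yt; apply/forallP => i; apply: leq_trans (Yt i).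
exact/subset_leq_card/fibS.
Qed.

Lemma thin_cardS S Y : S \subset Y -> thin_card S <= thin_card Y.
Proof.
move=> SY; apply: leq_sum => i _; rewrite leq_min geq_minl /=.
exact: leq_trans (geq_minr _ _) (subset_leq_card (fibS i SY)).
Qed.

Lemma ex_subset_card S k : k <= #|S| -> exists2 Y : {set T}, Y \subset S & #|Y| = k.
Proof.
elim: k => [|k IH] kS; first by exists set0; rewrite ?sub0set ?cards0.
have [Y YS Yk] := IH (ltnW kS).
have /properP[_ [u uS uY]] : Y \proper S by rewrite properEcard YS Yk.
by exists (u |: Y); rewrite ?subUset ?sub1set ?uS // cardsU1 uY Yk.
Qed.

(** Deleting a point from a block with more than s points of S does not lower [thin_card]; once S is
    thin, all its subsets are. *)
Lemma ex_thin_subset S k : k <= thin_card S ->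
  exists Y : {set T}, [/\ Y \subset S, thin Y & #|Y| = k].
Proof.
have [m] := ubnP #|S|; elim: m S => // m IH S Sm kS.
have [St|] := boolP (thin S).
  have [|Y YS Yk] := @ex_subset_card S k; last by exists Y; rewrite YS Yk (thin_sub YS).
  by apply: leq_trans kS _; rewrite -sum_card_fib leq_sum // => i _; apply: geq_minr.
rewrite negb_forall => /existsP[i]; rewrite -ltnNge => si.
have /card_gt0P[u] : 0 < #|fib S i| by apply: leq_ltn_trans si.
rewrite inE => /andP[uS /eqP bu].
have fibE j : fib (S :\ u) j = fib S j :\ u.
  by apply/setP => v; rewrite !inE andbA.
have [|| Y [YS Yt Yk]] := IH (S :\ u).
- by move: Sm; rewrite (cardsD1 u) uS.
- apply: leq_trans kS _; apply: leq_sum => j _; rewrite fibE.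
  have := cardsD1 u (fib S j); rewrite inE uS bu; case: (eqVneq i j) => [ij|_] /= ->.
    by move: si; rewrite ij; have := cardsD1 u (fib S j); rewrite inE uS bu ij eqxx /=; lia.
  by rewrite add0n.
by exists Y; split=> //; apply: subset_trans YS (subsetDl _ _).
Qed.

End Thin.

Lemma leq_sum_eq (J : finType) (f g : J -> nat) : (forall j, f j <= g j) ->
  \sum_j g j <= \sum_j f j -> forall j, f j = g j.
Proof.
move=> fg gf j; apply/eqP; rewrite eqn_leq fg /=.
move: gf; rewrite (bigD1 j) //= [X in _ <= X](bigD1 j) //=.
have : \sum_(i | i != j) f i <= \sum_(i | i != j) g i by apply: leq_sum.
lia.
Qed.

Section GoodFamilies.
Variables (T J : finType).
Implicit Types (F V : {set {set T}}) (D : {set T}) (X : {ffun J -> {set T}}).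

Definition disjoint_family X := [forall i, forall j, (i != j) ==> [disjoint X i & X j]].

Lemma disjoint_familyP X :
  reflect (forall i j, i != j -> [disjoint X i & X j]) (disjoint_family X).
Proof.
apply: (iffP forallP) => dX i; first by move=> j; apply: (implyP (forallP (dX i) j)).
by apply/forallP => j; apply/implyP; apply: dX.
Qed.

Lemma sum_disjoint_family X D : disjoint_family X -> (forall j, X j \subset D) ->
  \sum_j #|X j| <= #|D|.
Proof.
move=> /disjoint_familyP dX XD.
have -> : \sum_j #|X j| = #|\bigcup_j X j|.
  rewrite -sum1_card partition_disjoint_bigcup //=.
  by apply: eq_bigr => j _; rewrite sum1_card.
by apply: subset_leq_card; apply/bigcupsP.
Qed.

(* [X] witnesses that the equitable #|J|-colorability defect of F on the ground set D is at most
   (#|J| - 1) * t. *)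
Definition good F D t X :=
  [&& disjoint_family X, [forall j, X j \subset D], [forall i, forall j, #|X i| <= #|X j|.+1],
      [forall j, forall S in F, ~~ (S \subset X j)] & #|D| <= \sum_j #|X j| + #|J|.-1 * t].

Lemma goodP F D t X : reflect
  [/\ disjoint_family X, (forall j, X j \subset D), (forall i j, #|X i| <= #|X j|.+1),
      (forall j S, S \in F -> ~~ (S \subset X j)) & #|D| <= \sum_j #|X j| + #|J|.-1 * t]
  (good F D t X).
Proof.
apply: (iffP and5P) => [[dX /forallP XD /forallP eX /forallP FX tX]|[dX XD eX FX tX]].
  split=> // [i j|j S SF]; first exact: (forallP (eX i)).
  exact: (forall_inP (FX j)).
split=> //; first exact/forallP.
  by apply/forallP => i; apply/forallP => j.
by apply/forallP => j; apply/forall_inP => S; apply: FX.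
Qed.

Lemma good_set0 F D t : set0 \notin F -> #|D| <= #|J|.-1 * t -> good F D t [ffun=> set0].
Proof.
move=> F0 Dt; apply/goodP; split.
- by apply/disjoint_familyP => i j _; rewrite ffunE disjoints_subset sub0set.
- by move=> j; rewrite ffunE sub0set.
- by move=> i j; rewrite !ffunE cards0.
- by move=> j S SF; rewrite ffunE subset0; apply: contraNneq F0 => <-.
- exact: leq_trans Dt (leq_addl _ _).
Qed.

Definition monochromatic_family V (c : {set T} -> nat) a X :=
  disjoint_family X && [forall j, (X j \in V) && (c (X j) == a)].

Definition kneser_vertices (I : finType) (b : T -> I) s F D :=
  [set S in F | (S \subset D) && thin b s S].

End GoodFamilies.

(* The theorem is the case s = 1; other values of s serve in [kneser_bound_prod]. *)
Definition kneser_bound (J : finType) : Prop :=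
  forall (T I : finType) (b : T -> I) (s t : nat) (D : {set T}) (F : {set {set T}})
    (c : {set T} -> nat), set0 \notin F ->
  (forall i, #|fib b D i| <= #|J| * s) ->
  (forall S, S \in kneser_vertices b s F D -> c S < t) ->
  (forall (a : nat) (X : {ffun J -> {set T}}),
     ~~ monochromatic_family (kneser_vertices b s F D) c a X) ->
  exists X : {ffun J -> {set T}}, good F D t X.

Section PrimeCase.
Import GRing.Theory.
Variables (p : nat) (p_pr : prime p) (T I : finType) (b : T -> I) (s t : nat).
Variables (D : {set T}) (F : {set {set T}}) (c : {set T} -> nat).
Let V := kneser_vertices b s F D.

Hypothesis F0 : set0 \notin F.
Hypothesis fibD : forall i, #|fib b D i| <= p * s.
Hypothesis c_lt : forall S, S \in V -> c S < t.
Hypothesis not_mono : forall a (X : {ffun 'F_p -> {set T}}), ~~ monochromatic_family V c a X.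

Local Notation family := {ffun 'F_p -> {set T}}.
Implicit Types (X Y : family) (j : 'F_p) (a : 'F_p) (x y : sgvec p T).

Definition const (U : eqType) (w : {ffun 'F_p -> U}) := [forall j, forall k, w j == w k].

Lemma constP (U : eqType) (w : {ffun 'F_p -> U}) :
  reflect (forall j k, w j = w k) (const w).
Proof.
apply: (iffP forallP) => wc j; first by move=> k; apply/eqP; apply: (forallP (wc j)).
by apply/forallP => k; apply/eqP.
Qed.

Lemma const_shift (U : eqType) a (w : {ffun 'F_p -> U}) : const (shift_ffun a w) = const w.
Proof.
apply/constP/constP => wc j k; last by rewrite !ffunE.
by have := wc (j + a)%R (k + a)%R; rewrite !ffunE !addrK.
Qed.

Definition parts x : family := [ffun j => [set u | x u == Some j]].
Definition profile X : {ffun 'F_p -> {ffun I -> nat}} :=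
  [ffun j => [ffun i => minn s #|fib b (X j) i|]].
Definition height X := thin_card b s (X [arg min_(j < (0%R : 'F_p)) thin_card b s (X j)]).
(** The sizes of a largest equitable family of thin subsets of the parts: cutting off at the minimum
    plus one is what equity allows. *)
Definition levels X : {ffun 'F_p -> nat} := [ffun j => minn (thin_card b s (X j)) (height X).+1].
Definition colored_parts X (k : 'I_t) :=
  [set j | [exists S in V, (c S == k) && (S \subset X j)]].
Definition colored X := [exists k, colored_parts X k != set0].

(* The sign of X will be read off its key, which must not change along comparable families of the
   same level: hence a component is used only where the preceding ones are constant. *)
Definition key X : {ffun 'F_p -> {ffun 'I_t -> bool} * nat * {ffun I -> nat} * {set T}} :=
  [ffun j => ([ffun k => j \in colored_parts X k],
     if colored X then 0 else levels X j,
     if ~~ colored X && const (levels X) then profile X j else [ffun=> 0],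
     if [&& ~~ colored X, const (levels X) & const (profile X)] then X j else set0)].

Lemma keyE X j : key X j =
  ([ffun k => j \in colored_parts X k],
   if colored X then 0 else levels X j,
   if ~~ colored X && const (levels X) then profile X j else [ffun=> 0],
   if [&& ~~ colored X, const (levels X) & const (profile X)] then X j else set0).
Proof. by rewrite ffunE. Qed.

Lemma height_le X j : height X <= thin_card b s (X j).
Proof. by rewrite /height; case: arg_minnP => // i _; apply. Qed.

Lemma height_max X h : (forall j, h <= thin_card b s (X j)) -> h <= height X.
Proof. by move=> hX; rewrite /height. Qed.

Lemma height_shift a X : height (shift_ffun a X) = height X.
Proof.
apply/eqP; rewrite eqn_leq; apply/andP; split; apply: height_max => j.
  by have := height_le (shift_ffun a X) (j + a)%R; rewrite ffunE addrK.
by rewrite ffunE height_le.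
Qed.

Lemma levels_shift a X : levels (shift_ffun a X) = shift_ffun a (levels X).
Proof. by apply/ffunP => j; rewrite !ffunE height_shift. Qed.

Lemma profile_shift a X : profile (shift_ffun a X) = shift_ffun a (profile X).
Proof. by apply/ffunP => j; rewrite !ffunE. Qed.

Lemma mem_colored_parts_shift a X k j :
  (j \in colored_parts (shift_ffun a X) k) = ((j - a)%R \in colored_parts X k).
Proof. by rewrite !inE; apply: eq_existsb => S; rewrite ffunE. Qed.

Lemma colored_shift a X : colored (shift_ffun a X) = colored X.
Proof.
apply: eq_existsb => k; apply/set0Pn/set0Pn => -[j].
  by rewrite mem_colored_parts_shift; exists (j - a)%R.
by move=> jX; exists (j + a)%R; rewrite mem_colored_parts_shift addrK.
Qed.

Lemma key_shift a X : key (shift_ffun a X) = shift_ffun a (key X).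
Proof.
apply/ffunP => j; rewrite shift_ffunE !keyE colored_shift levels_shift profile_shift.
rewrite !const_shift !shift_ffunE; congr (_, _, _, _); apply/ffunP => k.
by rewrite ffunE [RHS]ffunE mem_colored_parts_shift.
Qed.

Lemma parts_turn a x : parts (turn a x) = shift_ffun a (parts x).
Proof.
apply/ffunP => j; rewrite !ffunE; apply/setP => u; rewrite !inE ffunE.
by case: (x u) => //= v; rewrite !(inj_eq (@Some_inj _)) -subr_eq opprK.
Qed.

Lemma parts_disjoint x : disjoint_family (parts x).
Proof.
apply/disjoint_familyP => i j ij; rewrite -setI_eq0; apply/eqP/setP => u.
by rewrite !ffunE !inE; case: eqP => // ->; rewrite (inj_eq (@Some_inj _)) (negPf ij).
Qed.

Lemma parts_sub x : signed_on (mem D) x -> forall j, parts x j \subset D.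
Proof.
case/andP => _ /forallP xD j; apply/subsetP => u; rewrite ffunE inE => /eqP xu.
by have := xD u; rewrite xu.
Qed.

Lemma sgle_parts x y : sgle x y -> forall j, parts x j \subset parts y j.
Proof.
by move=> /sgleP xy j; apply/subsetP => u; rewrite !ffunE !inE => /eqP xu; rewrite -xy xu.
Qed.

Lemma levels_le X Y : (forall j, X j \subset Y j) -> forall j, levels X j <= levels Y j.
Proof.
move=> XY j; rewrite !ffunE.
have hXY : height X <= height Y.
  by apply: height_max => k; apply: leq_trans (height_le X k) _; apply: thin_cardS.
by have := thin_cardS b s (XY j); lia.
Qed.

Lemma colored_parts_sub X Y : (forall j, X j \subset Y j) ->
  forall k, colored_parts X k \subset colored_parts Y k.
Proof.
move=> XY k; apply/subsetP => j; rewrite !inE => /exists_inP[S SV /andP[cS SX]].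
by apply/exists_inP; exists S => //; rewrite cS (subset_trans SX).
Qed.

(** Vertices of color k, one from each part, would form a monochromatic family. *)
Lemma colored_parts_proper x k : colored_parts (parts x) k != setT.
Proof.
apply/eqP => full.
have all_c j : exists S, [&& S \in V, c S == k & S \subset parts x j].
  have : j \in colored_parts (parts x) k by rewrite full.
  by rewrite inE => /exists_inP[S SV /andP[cS Sx]]; exists S; rewrite SV cS.
pose X : family := [ffun j => xchoose (all_c j)].
have XP j : [&& X j \in V, c (X j) == k & X j \subset parts x j].
  by rewrite ffunE; apply: (xchooseP (all_c j)).
have /negP := not_mono k X; apply; apply/andP; split.
  apply/disjoint_familyP => i j ij; have /disjoint_familyP/(_ _ _ ij) := parts_disjoint x.
  have [/and3P[_ _ Xi] /and3P[_ _ Xj]] := (XP i, XP j).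
  by move=> d; apply: disjointWl Xi _; apply: disjointWr Xj _.
by apply/forallP => j; have /and3P[-> -> _] := XP j.
Qed.

Lemma not_const_ex (U : eqType) (w : {ffun 'F_p -> U}) : ~~ const w -> exists j k, w j != w k.
Proof. by move=> /forallPn[j /forallPn[k wjk]]; exists j, k. Qed.

(** If every component were constant, no color would occur, since a color misses some part. Then
    levels and profile are constant too, so the last component is the family itself, whose parts are
    disjoint and not all empty. *)
Lemma key_not_const x : signed_on (mem D) x ->
  exists j k, key (parts x) j != key (parts x) k.
Proof.
move=> xD; set X := parts x.
apply: not_const_ex; apply/negP => /constP key_const.
have colE k j j' : (j \in colored_parts X k) = (j' \in colored_parts X k).
  by have := key_const j j'; rewrite !keyE => -[/ffunP/(_ k)]; rewrite !ffunE.
have ncol : ~~ colored X.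
  apply/negP => /existsP[k /set0Pn[j jk]]; have /eqP := colored_parts_proper x k; apply.
  by apply/setP => j'; rewrite in_setT (colE _ _ j).
have lc : const (levels X).
  by apply/constP => j j'; have := key_const j j'; rewrite !keyE (negPf ncol) => -[].
have pc : const (profile X).
  by apply/constP => j j'; have := key_const j j'; rewrite !keyE ncol lc => -[].
case/andP: xD => /existsP[u]; case xu: (x u) => [j|] // _ _.
have := key_const j (j + 1)%R; rewrite !keyE ncol lc pc => -[_ _ _ /setP/(_ u)].
rewrite !ffunE !inE xu eqxx => /esym/eqP[] /eqP.
by rewrite -subr_eq0 opprD addNKr oppr_eq0 oner_eq0.
Qed.

Lemma profile_eq X Y : (forall j, X j \subset Y j) -> levels X = levels Y ->
  const (levels X) -> profile X = profile Y.
Proof.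
move=> XY lXY lc.
(* A part of minimal [thin_card] is not cut off, so constant levels all equal [height] and no part
   is cut off. *)
have flat Z : const (levels Z) -> forall j, thin_card b s (Z j) = height Z.
  move=> /constP Zc j; have [j0 hj0] : exists j0, height Z = thin_card b s (Z j0) by eexists.
  have := height_le Z j; have := Zc j j0; rewrite !ffunE -hj0; lia.
have hXY : height X = height Y.
  have := congr1 (fun w : {ffun _ -> nat} => w (0%R : 'F_p)) lXY.
  by rewrite !ffunE !flat -?lXY //; lia.
apply/ffunP => j; apply/ffunP => i; rewrite !ffunE.
apply: (leq_sum_eq (f := fun i => minn s #|fib b (X j) i|)
                   (g := fun i => minn s #|fib b (Y j) i|)) => [i'|].
  by rewrite leq_min geq_minl /= (leq_trans (geq_minr _ _)) // subset_leq_card // fibS.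
have := flat Y; rewrite -lXY => /(_ lc j); have := flat X lc j.
by rewrite /thin_card => -> ->; rewrite hXY.
Qed.

(* This is where the bound on the block sizes enters: in a block whose constant profile is s, each
   of the p parts takes s elements, so that X already exhausts the block. *)
Lemma const_profile_eq X Y : (forall j, X j \subset Y j) -> disjoint_family Y ->
  (forall j, Y j \subset D) -> profile X = profile Y -> const (profile X) -> X = Y.
Proof.
move=> XY dY YD pXY /constP pc; apply/ffunP => j; apply/eqP; rewrite eqEcard XY /=.
rewrite -(sum_card_fib b (X j)) -(sum_card_fib b (Y j)); apply: leq_sum => i _.
have pi k : minn s #|fib b (X k) i| = minn s #|fib b (X j) i|.
  by have /ffunP/(_ i) := pc k j; rewrite !ffunE.
have pY k : minn s #|fib b (X k) i| = minn s #|fib b (Y k) i|.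
  by have /ffunP/(_ k)/ffunP/(_ i) := pXY; rewrite !ffunE.
(* A profile below s is the exact size of the trace. *)
have [lt_s|ge_s] := ltnP #|fib b (X j) i| s; first by have := pY j; lia.
pose Z : family := [ffun k => fib b (Y k) i].
have sumZ : \sum_k #|Z k| <= #|fib b D i|.
  apply: sum_disjoint_family => [|k]; last by rewrite ffunE fibS.
  apply/disjoint_familyP => k k' kk'; rewrite !ffunE.
  have /disjoint_familyP/(_ _ _ kk') := dY.
  move=> d; have sub S : fib b S i \subset S by apply/subsetP => u; rewrite inE => /andP[].
  by apply: disjointWl (sub _) _; apply: disjointWr (sub _) _.
have sumX : p * s <= \sum_k #|fib b (X k) i|.
  apply: (@leq_trans (\sum_(k : 'F_p) s)); first by rewrite sum_nat_const card_Fp.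
  apply: leq_sum => k _.
  by have := pi k; lia.
rewrite (leq_sum_eq (f := fun k => #|fib b (X k) i|) (g := fun k => #|fib b (Y k) i|)) //.
  by move=> k; rewrite subset_leq_card // fibS.
apply: leq_trans sumX; apply: leq_trans (fibD i); apply: leq_trans sumZ.
by apply: leq_sum => k _; rewrite ffunE.
Qed.

(** The level lowered by one: on non-zero vectors the levels are positive, so they range from 1 to
    #|D| - 1, and the ranks stay below #|D| - 1. *)
Definition rank alpha X := (minn (\sum_j levels X j) alpha + \sum_k #|colored_parts X k|).-1.

(** Both summands of the level are monotone, so neither changes. Hence the colored parts agree; if
    there are none, the truncation at alpha is inactive, so the levels agree, and then profiles and
    parts agree wherever the key records them. *)
Lemma key_eq alpha x y : signed_on (mem D) y -> sgle x y ->
  (forall z, ~~ colored (parts z) -> signed_on (mem D) z -> \sum_j levels (parts z) j <= alpha) ->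
  signed_on (mem D) x ->
  0 < minn (\sum_j levels (parts x) j) alpha + \sum_k #|colored_parts (parts x) k| ->
  rank alpha (parts x) = rank alpha (parts y) -> key (parts x) = key (parts y).
Proof.
move=> yD xy le_alpha xD; rewrite /rank; set X := parts x; set Y := parts y => rX rXY.
have XY : forall j, X j \subset Y j := sgle_parts xy.
have leL : \sum_j levels X j <= \sum_j levels Y j by apply: leq_sum => j _; apply: levels_le.
have leC k : #|colored_parts X k| <= #|colored_parts Y k|.
  exact/subset_leq_card/colored_parts_sub.
have leCs : \sum_k #|colored_parts X k| <= \sum_k #|colored_parts Y k|.
  by apply: leq_sum => k _; apply: leC.
have eqC k : colored_parts X k = colored_parts Y k.
  apply/eqP; rewrite eqEcard colored_parts_sub //=.
  by rewrite (leq_sum_eq leC) //; lia.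
have eqcol : colored X = colored Y by apply: eq_existsb => k; rewrite eqC.
apply/ffunP => j; rewrite !keyE -eqcol; under eq_ffun do rewrite eqC.
have [//|ncol] := boolP (colored X).
have eqL : levels X = levels Y.
  have lX : \sum_j levels X j <= alpha by apply: le_alpha.
  have lY : \sum_j levels Y j <= alpha by apply: le_alpha => //; rewrite -eqcol.
  apply/ffunP; apply: leq_sum_eq; first exact: levels_le.
  rewrite (minn_idPl lX) (minn_idPl lY) in rX rXY.
  have aux u u' v v' : 0 < u + v -> (u + v).-1 = (u' + v').-1 -> u <= u' -> v <= v' -> u' <= u.
    by clear; lia.
  exact: aux rX rXY leL leCs.
rewrite -eqL; have [lc|//] := boolP (const (levels X)).
rewrite -(profile_eq XY eqL lc); have [pc|//] := boolP (const (profile X)).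
rewrite (const_profile_eq XY (parts_disjoint y) (parts_sub yD) (profile_eq XY eqL lc) pc).
by [].
Qed.

Lemma levels_gt0 x : signed_on (mem D) x -> 0 < \sum_j levels (parts x) j.
Proof.
move=> xD; have /andP[/existsP[u xu] _] := xD.
case xuj: (x u) xu => [j|] // _; rewrite (bigD1 j) //= ffunE.
have uX : u \in parts x j by rewrite ffunE inE xuj.
have uD : u \in D by apply: (subsetP (parts_sub xD j)).
(* For s = 0 the bound on the blocks would make D empty. *)
have s0 : 0 < s.
  have : 0 < #|fib b D (b u)| by apply/card_gt0P; exists u; rewrite inE uD eqxx.
  by have := fibD (b u); case: s => //; rewrite muln0; lia.
suff : 0 < thin_card b s (parts x j) by lia.
rewrite /thin_card (bigD1 (b u)) //=; apply: ltn_addr; rewrite leq_min s0 /=.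
by apply/card_gt0P; exists u; rewrite inE uX eqxx.
Qed.

Lemma exists_good_prime : exists X : family, good F D t X.
Proof.
apply/existsP; apply: contraT; rewrite negb_exists => /forallP no.
have tD : p.-1 * t < #|D|.
  by rewrite ltnNge; apply: contra (no [ffun=> set0]) => Dt; apply: good_set0; rewrite ?card_Fp.
(* There are at most (p - 1) * t colored pairs, so the levels are at most #|D| - 1. *)
pose alpha := #|D|.-1 - p.-1 * t.
(* Thin subsets of the parts with sizes [levels] are equitable. A member of F inside one of them
   would be a vertex and have a color, so a sum above alpha would yield a good family. *)
have le_alpha z : ~~ colored (parts z) -> signed_on (mem D) z ->
    \sum_j levels (parts z) j <= alpha.
  move=> ncol zD; rewrite leqNgt; apply/negP => lt_alpha.
  have exY j : exists Y : {set T},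
      [&& Y \subset parts z j, thin b s Y & #|Y| == levels (parts z) j].
    have [|Y [Yz Yt Yk]] := @ex_thin_subset _ _ b s (parts z j) (levels (parts z) j).
      by rewrite ffunE geq_minl.
    by exists Y; rewrite Yz Yt Yk eqxx.
  pose X : family := [ffun j => xchoose (exY j)].
  have XP j : [&& X j \subset parts z j, thin b s (X j) & #|X j| == levels (parts z) j].
    by rewrite ffunE; apply: (xchooseP (exY j)).
  have cardX j : #|X j| = levels (parts z) j by have /and3P[_ _ /eqP] := XP j.
  have XD j : X j \subset D.
    by have /and3P[Xz _ _] := XP j; apply: subset_trans Xz (parts_sub zD j).
  have /negP := no X; apply; apply/goodP; split=> //.
  - apply/disjoint_familyP => i j ij; have /disjoint_familyP/(_ _ _ ij) := parts_disjoint z.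
    have [/and3P[Xi _ _] /and3P[Xj _ _]] := (XP i, XP j).
    by move=> d; apply: disjointWl Xi _; apply: disjointWr Xj _.
  - by move=> i j; rewrite !cardX ![levels _ _]ffunE; have := height_le (parts z) j; lia.
  - move=> j S SF; apply/negP => SX; case/negP: ncol; have /and3P[Xz Xt _] := XP j.
    have SV : S \in V by rewrite inE SF (subset_trans SX) // (thin_sub SX).
    apply/existsP; exists (Ordinal (c_lt SV)); apply/set0Pn; exists j; rewrite inE.
    by apply/exists_inP; exists S => //; rewrite eqxx (subset_trans SX).
  under eq_bigr do rewrite cardX; rewrite card_Fp //.
  by move: lt_alpha tD; rewrite /alpha; lia.
have [pivot pivotE] := exists_pivot p
  [the choiceType of {ffun 'I_t -> bool} * nat * {ffun I -> nat} * {set T}]%type.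
have rank_gt0 x : signed_on (mem D) x ->
    0 < minn (\sum_j levels (parts x) j) alpha + \sum_k #|colored_parts (parts x) k|.
  move=> xD; have l0 := levels_gt0 xD.
  have [/existsP[k kx]|ncol] := boolP (colored (parts x)).
    by rewrite (bigD1 k) //= addnCA ltn_addr // card_gt0.
  by have := le_alpha x ncol xD; lia.
have D0 : 0 < #|D| := leq_ltn_trans (leq0n _) tD.
suff : #|D| <= #|D|.-1 by rewrite leqNgt prednK // leqnn.
apply: (@signed_on_tucker p T D (fun x => pivot (key (parts x)))
         (fun x => rank alpha (parts x))) => //.
- move=> a x xD; have [j [k jk]] := key_not_const xD.
  by rewrite parts_turn key_shift (pivotE _ _ _ _ jk).
- move=> x y xD yD xy; have XY := sgle_parts xy; rewrite /rank.
  have leL : \sum_j levels (parts x) j <= \sum_j levels (parts y) j.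
    by apply: leq_sum => j _; apply: levels_le.
  have : \sum_k #|colored_parts (parts x) k| <= \sum_k #|colored_parts (parts y) k|.
    by apply: leq_sum => k _; apply/subset_leq_card/colored_parts_sub.
  lia.
- move=> x y xD yD xy rxy; congr pivot; apply: (key_eq yD xy le_alpha xD _ rxy).
  exact: rank_gt0.
move=> x xD; have r0 := rank_gt0 x xD; rewrite /rank.
have : \sum_k #|colored_parts (parts x) k| <= t * p.-1.
  rewrite -[t in t * _]card_ord -sum_nat_const; apply: leq_sum => k _.
  have := colored_parts_proper x k; rewrite -subTset => nT.
  have : #|colored_parts (parts x) k| < #|[set: 'F_p]|.
    by apply: proper_card; rewrite properE subsetT.
  by rewrite cardsT card_Fp // => lt_p; rewrite -ltnS prednK ?prime_gt0.
by move: tD r0; rewrite /alpha mulnC; lia.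
Qed.

End PrimeCase.

(** * Reduction to prime r *)

Lemma kneser_bound_prime (p : nat) : prime p -> kneser_bound 'F_p.
Proof.
move=> p_pr T I b s t D F c F0 fibD c_lt not_mono.
apply: (exists_good_prime p_pr F0 _ c_lt not_mono) => i.
by rewrite -[X in X * _](card_Fp p_pr).
Qed.

Lemma kneser_bound_card (J J' : finType) : #|J| = #|J'| -> kneser_bound J -> kneser_bound J'.
Proof.
move=> cardJ KJ T I b s t D F c F0 fibD c_lt not_mono.
pose f (j : J') : J := enum_val (cast_ord (esym cardJ) (enum_rank j)).
pose g (j : J) : J' := enum_val (cast_ord cardJ (enum_rank j)).
have fK : cancel f g by move=> j; rewrite /f /g enum_valK cast_ordKV enum_rankK.
have gK : cancel g f by move=> j; rewrite /f /g enum_valK cast_ordK enum_rankK.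
have [|a X|X /goodP[dX XD eX FX tX]] := KJ T I b s t D F c F0 _ c_lt.
- by move=> i; rewrite cardJ.
- apply: contra (not_mono a [ffun j => X (f j)]) => /andP[/disjoint_familyP dX /forallP XV].
  apply/andP; split; last by apply/forallP => j; rewrite ffunE.
  by apply/disjoint_familyP => i j ij; rewrite !ffunE dX // (inj_eq (can_inj fK)).
exists [ffun j => X (f j)]; apply/goodP; split.
- apply/disjoint_familyP => i j ij; rewrite !ffunE; apply: (disjoint_familyP _ dX).
  by rewrite (inj_eq (can_inj fK)).
- by move=> j; rewrite ffunE.
- by move=> i j; rewrite !ffunE.
- by move=> j S SF; rewrite ffunE FX.
have sumE : \sum_j #|X j| = \sum_j #|X (f j)|.
  by apply: reindex; exists g => j _; [apply: fK | apply: gK].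
by under eq_bigr do rewrite ffunE; rewrite -sumE -cardJ.
Qed.

(** Points are removed one at a time, always from a largest part, which keeps the family
    equitable. *)
Lemma trim_family (T J : finType) (X : {ffun J -> {set T}}) (m : nat) :
  (forall i j, #|X i| <= #|X j|.+1) -> m <= \sum_j #|X j| ->
  exists Y : {ffun J -> {set T}}, [/\ forall j, Y j \subset X j,
    forall i j, #|Y i| <= #|Y j|.+1 & \sum_j #|Y j| = m].
Proof.
move=> eX mX; have [d dE] : exists d, \sum_j #|X j| = m + d 
  by exists (\sum_j #|X j| - m); rewrite subnKC.
elim: d X eX {mX} dE => [|d IH] X eX dE; first by exists X; split=> //; rewrite dE addn0.
have [i0 _] : exists i0, i0 \in J.
  case: (pickP J) => [i0 _|J0]; first by exists i0.
  by move: dE; rewrite big_pred0 // addnS.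
have [i max_i] : exists i, forall j, #|X j| <= #|X i|.
  by have [i _ max_i] := @arg_maxnP J i0 predT (fun j => #|X j|) isT; exists i => j; apply: max_i.
have /card_gt0P[u uX] : 0 < #|X i|.
  rewrite lt0n; apply/eqP => Xi0; have : \sum_j #|X j| = 0.
    by apply: big1 => j _; apply/eqP; rewrite -leqn0 -Xi0.
  by rewrite dE addnS.
pose X' : {ffun J -> {set T}} := [ffun j => if j == i then X i :\ u else X j].
have X'X j : X' j \subset X j by rewrite ffunE; case: eqP => // ->; apply: subsetDl.
have cXi : #|X i| = #|X' i|.+1 by rewrite ffunE eqxx (cardsD1 u) uX.
have cX j : j != i -> #|X' j| = #|X j| by rewrite ffunE => /negPf->.
have [j j'||Y [YX eY sY]] := IH X'.
- have [->|ji] := eqVneq j i; have [->|j'i] := eqVneq j' i.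
  + exact: leqnSn.
  + by rewrite (cX j') //; have := eX i j'; rewrite cXi => /ltnW.
  + by rewrite (cX j) // -cXi.
  by rewrite !cX.
- move: dE; rewrite (bigD1 i) //= [in X in _ -> X](bigD1 i) //= cXi addSn addnS => -[<-].
  by congr (_ + _); apply: eq_bigr => j ji; rewrite cX.
exists Y; split=> // j; exact: subset_trans (YX j) (X'X j).
Qed.

(** If f i were at least g j + 2, then f would be at least g j + 1 everywhere, strictly at i, and g
    at most g j + 1, strictly at j; the sums would differ by at least 2. *)
Lemma equitable_sum_le (J : finType) (f g : J -> nat) :
  (forall i j, f i <= (f j).+1) -> (forall i j, g i <= (g j).+1) ->
  \sum_j f j <= (\sum_j g j).+1 -> forall i j, f i <= (g j).+1.
Proof.
move=> ef eg fg i j; rewrite leqNgt; apply/negP => gf.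
have f_ge : \sum_(k : J) (g j).+1 < \sum_k f k.
  rewrite (bigD1 i) //= [X in _ < X](bigD1 i) //= -addSn leq_add // leq_sum // => k _.
  by rewrite -ltnS (leq_trans gf).
have g_le : \sum_k g k < \sum_(k : J) (g j).+1.
  by rewrite (bigD1 j) //= [X in _ < X](bigD1 j) //= -addSn leq_add // leq_sum.
have := leq_ltn_trans g_le f_ge; rewrite ltnNge => /negP; apply.
by apply: leq_trans fg _.
Qed.

Section Product.
Variables (J1 J2 : finType).

(* Kriz's reduction: apply the bound for J2 to the family of the sets N whose J1-colorability defect
   is more than (#|J1| - 1) * t. By the bound for J1 such an N, when thin, contains #|J1| disjoint
   vertices of one color, which serves as the color of N. *)
Lemma kneser_bound_prod : 0 < #|J1| -> 0 < #|J2| ->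
  kneser_bound J1 -> kneser_bound J2 -> kneser_bound (J1 * J2)%type.
Proof.
move=> J1_gt0 J2_gt0 K1 K2 T I b s t D F c F0 fibD c_lt not_mono.
pose r1 := #|J1|; pose r2 := #|J2|; pose K := r1.-1 * t.
have [j1 _] : exists j1, j1 \in J1 by apply/card_gt0P.
pose F1 := [set N : {set T} | ~~ [exists X : {ffun J1 -> {set T}}, good F N t X]].
pose mono (N : {set T}) (aX : 'I_t * {ffun J1 -> {set T}}) :=
  monochromatic_family (kneser_vertices b s F N) c aX.1 aX.2.
(* The default 0 is never taken on [V1], by [c1P]. *)
pose c1 N : nat := if [pick aX | mono N aX] is Some aX then aX.1 else 0.
pose V1 := kneser_vertices b (r1 * s) F1 D.
have c1P N : N \in V1 -> c1 N < t /\
    exists X : {ffun J1 -> {set T}}, monochromatic_family (kneser_vertices b s F N) c (c1 N) X.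
  rewrite inE => /and3P[NF1 ND /forallP Nt]; rewrite /c1; case: pickP => [[a X] aX|no].
    by split; [apply: ltn_ord | exists X].
  have c_ltN S : S \in kneser_vertices b s F N -> c S < t.
    rewrite inE => /and3P[SF SN St]; apply: c_lt.
    by rewrite inE SF (subset_trans SN).
  move: NF1; rewrite inE => /negP; case; apply/existsP; apply: (K1 T I b s t N F c) => // a X.
  apply/negP => aX; have /andP[_ /forallP/(_ j1)/andP[Xj /eqP cX]] := aX.
  have a_lt : a < t by rewrite -cX c_ltN.
  by have := no (Ordinal a_lt, X); rewrite /mono /= aX.
have [||N /c1P[]||Y /goodP[/disjoint_familyP dY YD eY F1Y tY]] :=
    K2 T I b (r1 * s) t D F1 c1 _ _ _ _ => //.
- rewrite inE negbK; apply/existsP; exists [ffun=> set0].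
  by apply: good_set0; rewrite ?cards0.
- by move=> i; apply: leq_trans (fibD i) _; rewrite card_prod mulnA [r2 * _]mulnC.
- move=> a N; apply/negP => /andP[/disjoint_familyP dN /forallP NP].
  have exX j : exists X : {ffun J1 -> {set T}},
      monochromatic_family (kneser_vertices b s F (N j)) c a X.
    by have /andP[/c1P[_ [X NX]] /eqP <-] := NP j; exists X.
  have [X XP] := fin_all_exists exX.
  have /negP := not_mono a [ffun ij => X ij.2 ij.1]; apply.
  apply/andP; split.
    apply/disjoint_familyP => -[i j] [i' j'] ij; rewrite !ffunE /=.
    have [jj|jj] := eqVneq j j'.
      have /andP[/disjoint_familyP dX _] := XP j; rewrite -jj; apply: dX.
      by apply: contra ij => /eqP->; rewrite jj.
    have sub k l : X l k \subset N l.
      have /andP[_ /forallP/(_ k)/andP[]] := XP l.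
      by rewrite inE => /and3P[].
    by have := dN _ _ jj => d; apply: disjointWl (sub _ _) _; apply: disjointWr (sub _ _) _.
  apply/forallP => -[i j]; rewrite ffunE /=.
  have /andP[_ /forallP/(_ i)/andP[XV ->]] := XP j; rewrite andbT.
  have /andP[] := NP j; rewrite !inE => /and3P[_ ND _] _.
  by move: XV; rewrite inE => /and3P[-> XN ->]; rewrite (subset_trans XN).
have r12 : r2 * K + r2.-1 * t = #|{: J1 * J2}|.-1 * t.
  rewrite card_prod; have aux m1 m2 : 0 < m1 -> 0 < m2 ->
      m2 * (m1.-1 * t) + m2.-1 * t = (m1 * m2).-1 * t.
    by case: m1 m2 => // m1 [] // m2 _ _; rewrite mulnA -mulnDl; congr (_ * t); lia.
  exact: aux.
(* If no part exceeds K, then D is so small that the empty family is good. Otherwise equity gives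
   every part at least K points. *)
have [/forallP Y_le|] := boolP [forall j, #|Y j| <= K].
  exists [ffun=> set0]; apply: good_set0 => //; rewrite -r12; apply: leq_trans tY _.
  by rewrite leq_add2r -sum_nat_const leq_sum.
case/forallPn => j0; rewrite -ltnNge => lt_j0.
have Y_ge j : K <= #|Y j| by rewrite -ltnS (leq_trans lt_j0).
(* A good family in [Y j] misses at most K points; trimming it to miss exactly K makes the totals
   for different j differ by at most 1, as needed for equity of the union. *)
have exX j : exists X : {ffun J1 -> {set T}}, good F (Y j) t X /\
    \sum_i #|X i| = #|Y j| - K.
  have : Y j \notin F1 by apply/negP => /(F1Y j); rewrite subxx.
  rewrite inE negbK => /existsP[X /goodP[dX XY eX FX tX]].
  have [|X' [X'X eX' sX']] := trim_family eX (m := #|Y j| - K); first by rewrite leq_subLR addnC.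
  exists X'; split=> //; apply/goodP; split=> //.
  - apply/disjoint_familyP => i i' ii; have /disjoint_familyP/(_ _ _ ii) := dX.
    by move=> d; apply: disjointWl (X'X _) _; apply: disjointWr (X'X _) _.
  - by move=> i; apply: subset_trans (X'X i) (XY i).
  - by move=> i S SF; apply: contra (FX i S SF) => SX; apply: subset_trans SX (X'X i).
  by rewrite sX' subnK.
have [X XP] := fin_all_exists exX.
exists [ffun ij => X ij.2 ij.1]; apply/goodP; split.
- apply/disjoint_familyP => -[i j] [i' j'] ij; rewrite !ffunE /=.
  have [jj|jj] := eqVneq j j'.
    have [/goodP[/disjoint_familyP dX _ _ _ _] _] := XP j; rewrite -jj; apply: dX.
    by apply: contra ij => /eqP->; rewrite jj.
  have sub k l : X l k \subset Y l by have [/goodP[_ XY _ _ _] _] := XP l.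
  by have := dY _ _ jj => d; apply: disjointWl (sub _ _) _; apply: disjointWr (sub _ _) _.
- move=> [i j]; rewrite ffunE /=; have [/goodP[_ XY _ _ _] _] := XP j.
  exact: subset_trans (XY i) (YD j).
- move=> [i j] [i' j']; rewrite !ffunE /=.
  have [/goodP[_ _ eX _ _] sX] := XP j; have [/goodP[_ _ eX' _ _] sX'] := XP j'.
  apply: (equitable_sum_le (f := fun i => #|X j i|) (g := fun i => #|X j' i|)) => //.
  by rewrite sX sX'; have := eY j j'; have := Y_ge j'; lia.
- by move=> [i j] S SF; rewrite ffunE /=; have [/goodP[_ _ _ FX _] _] := XP j; apply: FX.
under eq_bigr do rewrite ffunE.
rewrite -(pair_bigA _ (fun i j => #|X j i|)) exchange_big /=.
under eq_bigr => j _ do have [_ ->] := XP j.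
rewrite -r12 addnA; apply: leq_trans tY _; rewrite leq_add2r.
rewrite -sum_nat_const -big_split /=; apply: leq_sum => j _.
by rewrite subnK.
Qed.

End Product.

(** Strong induction, splitting off the least prime divisor of r. *)
Lemma kneser_bound_all (r : nat) (J : finType) : 1 < r -> #|J| = r -> kneser_bound J.
Proof.
have [m] := ubnP r; elim: m r J => // m IH r J r_lt r_gt1 cardJ.
have p_pr := pdiv_prime r_gt1; have rE := divnK (pdiv_dvd r).
have [rp1|rp_gt1] := leqP (r %/ pdiv r) 1.
  apply: (kneser_bound_card (J := 'F_(pdiv r))); last exact: (kneser_bound_prime p_pr).
  rewrite card_Fp // cardJ -[RHS]rE.
  case: (r %/ pdiv r) rp1 rE => [|[]] // _; last by rewrite mul1n.
  by rewrite mul0n => r0; rewrite -r0 in r_gt1.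
apply: (kneser_bound_card (J := ('F_(pdiv r) * 'I_(r %/ pdiv r))%type)).
  by rewrite card_prod card_Fp // card_ord mulnC rE cardJ.
apply: kneser_bound_prod; rewrite ?card_Fp ?card_ord ?pdiv_gt0 ?(ltnW rp_gt1) //.
  exact: (kneser_bound_prime p_pr).
apply: (IH (r %/ pdiv r)) => //; last by rewrite card_ord.
by rewrite -ltnS (leq_trans _ r_lt) // ltnS ltn_Pdiv ?prime_gt1 // ltnW.
Qed.

(** * The bound for admissible vertices *)

Theorem theorem2 (n r : nat) (hn : 1 <= n) (hr : 2 <= r)
    (P : {set {set 'I_n}}) (hP : partition P [set: 'I_n])
    (hPr : forall B : {set 'I_n}, B \in P -> #|B| <= r)
    (F : {set {set 'I_n}}) (hF : set0 \notin F) :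
  (Num.ceil ((ecd r F)%:R / (r%:R - 1) : rat)
     <= Posz (chromatic_number (KG r F P)))%R.
Proof.
have edges_gt1 e : e \in KG r F P -> 1 < #|e| by rewrite inE => /andP[/eqP ->].
have [/existsP[col /forall_inP col_ok] _] := chromatic_numberP edges_gt1.
set t := chromatic_number _ in col col_ok *.
pose c (S : {set 'I_n}) : nat := if insub S is Some v then col (v : KG_vertex F P) else 0.
have [covP tiP _] := and3P hP.
have fib_block S B : B \in P -> fib (pblock P) S B = S :&: B.
  move=> BP; apply/setP => u; rewrite !inE; congr (_ && _).
  apply/eqP/idP => [<-|]; last exact: def_pblock.
  by rewrite mem_pblock (eqP covP) inE.
(* Blocks are indexed by all subsets of the ground set; those outside P have empty trace. *)
have fib0 S B : B \notin P -> fib (pblock P) S B = set0.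
  move=> BP; apply/setP => u; rewrite !inE; apply/negP => /andP[_ /eqP uB].
  by case/negP: BP; rewrite -uB pblock_mem // (eqP covP) inE.
have vertexP S : S \in kneser_vertices (pblock P) 1 F [set: 'I_n] ->
    exists2 v : KG_vertex F P, val v = S & c S = col v.
  rewrite inE subsetT /= => /andP[SF /forallP St].
  have SP : (S \in F) && admissible P S.
    by rewrite SF; apply/forall_inP => B BP; rewrite -fib_block.
  by exists (Sub S SP) => //; rewrite /c insubT.
have [|||X /goodP[dX _ eX FX tX]] :=
    @kneser_bound_all r 'I_r hr (card_ord r) _ _ (pblock P) 1 t [set: 'I_n] F c hF.
- move=> B; rewrite card_ord muln1; have [BP|BP] := boolP (B \in P).
    by rewrite fib_block // setTI hPr.
  by rewrite fib0 // cards0.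
- by move=> S /vertexP[v _ ->].
- move=> a X; apply/negP => /andP[/disjoint_familyP dX /forallP XV].
  have exv j : exists v : KG_vertex F P, val v = X j /\ c (X j) = col v.
    by have /andP[/vertexP[v vX cX] _] := XV j; exists v.
  have [v vP] := fin_all_exists exv.
  (* Disjoint vertices are distinct because no vertex is empty, so they form an edge with r
     elements. *)
  have v_inj : injective v.
    move=> i j vij; apply/eqP; apply: contraT => ij.
    have := dX _ _ ij; rewrite -(vP i).1 -(vP j).1 vij -setI_eq0 setIid => /eqP v0.
    by move: hF; rewrite -v0; have /andP[->] := valP (v j).
  have vE : [set v j | j : 'I_r] \in KG r F P.
    rewrite inE card_imset // card_ord eqxx /=.
    apply/forall_inP => _ /imsetP[i _ ->]; apply/forall_inP => _ /imsetP[j _ ->].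
    by apply/implyP => ij; rewrite (vP i).1 (vP j).1 dX //; apply: contraNneq ij => ->.
  case/negP: (col_ok _ vE); pose j0 := Ordinal (ltnW hr).
  apply/existsP; exists (col (v j0)); apply/forall_inP => _ /imsetP[j _ ->].
  apply/eqP/val_inj; rewrite /= -(vP j).2 -(vP j0).2.
  by have [/andP[_ /eqP ->] /andP[_ /eqP ->]] := (XV j, XV j0).
(* The points outside the good family are a legitimate set to remove, so they bound the defect. *)
have [_ /(_ (~: \bigcup_j X j))] := ecdP r hF.
have -> : equitably_r_colorable_without r F (~: \bigcup_j X j).
  apply/existsP; exists X; apply/andP; split.
    by apply/and3P; split; [rewrite setCK | exact: dX | apply/forallP => i; apply/forallP].
  by apply/forall_inP => S SF; apply/forallP => j; apply: FX.
have cardX : \sum_j #|X j| = #|\bigcup_j X j|.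
  rewrite -sum1_card partition_disjoint_bigcup /=; last exact/disjoint_familyP.
  by apply: eq_bigr => j _; rewrite sum1_card.
rewrite cardsCs setCK -cardX => /(_ isT) ecd_le.
have {}ecd_le : ecd r F <= t * r.-1.
  by apply: leq_trans ecd_le _; move: tX; rewrite cardsT !card_ord leq_subLR [t * _]mulnC.
have r1 : (r%:R - 1 : rat)%R = (r.-1)%:R%R by rewrite -subn1 GRing.natrB // ltnW.
rewrite Num.Theory.ceil_le_int r1 Num.Theory.ler_pdivrMr; last first.
  by rewrite Num.Theory.ltr0n -ltnS prednK // ltnW.
by rewrite -pmulrn -GRing.natrM Num.Theory.ler_nat.
Qed.
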